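(* (1) For every integer $n\ge 8$, the minimum of ${\rm cc}(G)$ over all $2$-connected graphs $G$ of order $n$ with girth at least $4$ equals $6$. (2) For every integer $n\ge 10$, the minimum of ${\rm cc}(G)$ over all $2$-connected graphs $G$ of order $n$ with girth at least $5$ equals $8$. (3) For every even integer $n\ge 12$, the minimum of ${\rm cc}(G)$ over all $2$-connected graphs $G$ of order $n$ with girth at least $6$ equals $8$; for every odd integer $n\ge 13$, this minimum equals $9$.
   Context: All graphs are finite and simple. The girth of a graph is the length of a shortest cycle. A cummerbund of a graph is a longest cycle; ${\rm cc}(G)$ is the number of vertices of $G$ lying in at least one cummerbund. *)

(* Defs.v *)
From mathcomp Require Import all_boot.
From Stdlib Require Import ClassicalEpsilon.
Set Implicit Arguments. Unset Strict Implicit. Unset Printing Implicit Defensive.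

Section Graphs.
Variable T : finType.
Variable e : rel T.

Definition simple_graph : Prop := symmetric e /\ irreflexive e.

Definition is_cycle (c : seq T) : Prop := [/\ uniq c, 3 <= size c & cycle e c].

Definition girth_at_least (g : nat) : Prop :=
  forall c, is_cycle c -> g <= size c.

Definition two_connected : Prop :=
  [/\ 3 <= #|T|,
      (forall x y, connect e x y) &
      (forall v x y, x != v -> y != v ->
         connect (fun a b => [&& e a b, a != v & b != v]) x y)].

Definition cummerbund (c : seq T) : Prop :=
  is_cycle c /\ forall c', is_cycle c' -> size c' <= size c.

Definition in_some_cummerbund (v : T) : Prop :=
  exists c, cummerbund c /\ v \in c.

Definition in_some_cummerbundb (v : T) : bool :=
  if excluded_middle_informative (in_some_cummerbund v) then true else false.

Definition cc : nat := #|[set v | in_some_cummerbundb v]|.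

End Graphs.

Definition min_cc_eq (n g m : nat) : Prop :=
  (forall e : rel 'I_n, simple_graph e -> two_connected e ->
     girth_at_least e g -> m <= cc e) /\
  (exists e : rel 'I_n, [/\ simple_graph e, two_connected e,
     girth_at_least e g & cc e = m]).

(* Main.v *)
Require Import Defs.
From mathcomp Require Import all_boot.
From mathcomp Require Import zify.
From Stdlib Require Import ClassicalEpsilon.
Set Implicit Arguments. Unset Strict Implicit. Unset Printing Implicit Defensive.

(** Lower bounds: let C be a longest cycle. By 2-connectedness every vertex
    outside C lies on an ear of C, that is, on a path with distinct ends on C and
    all inner vertices outside C. Replacing an arc of C by an ear cannot produce a
    longer cycle nor a cycle shorter than the girth, and if it produces another
    longest cycle then the inner vertices of the ear lie in a cummerbund. When C
    is short these constraints, together with those coming from two crossing ears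
    and from two ears with the same ends, leave very few possible ears. For girth
    6 and |C| = 8, either some ear vertex is in a cummerbund or all ears have the
    same antipodal ends and two inner vertices each, so that the order is even.

    Upper bounds: in a theta graph every cycle is the union of two of the paths;
    take paths with numbers of inner vertices 2, 2, 1, ..., 1 for girth 4, then
    3, 3, (1,) 2, ..., 2 for girth 5 and for girth 6 and even order, and
    3, 4, 2, ..., 2 for girth 6 and odd order. *)

(** Cut a repetition-free path at its first vertex in [X]. Ears arise from such cuts: the segment
    before [t] supplies inner vertices, and [t] is an end or a point of attachment. *)
Lemma first_hit (T : finType) (r : rel T) (X : pred T) z s :
  connect r z s -> ~~ X z -> X s ->
  exists q t, [/\ path r z (rcons q t), uniq (z :: q), ~~ has X (z :: q) & X t].
Proof.
move=> /connectP [p0 /shortenP [p pP pU _] ->] zX lX.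
have hX : has X p.
  have := mem_last z p; rewrite inE => /orP [/eqP lz|lp]; last by apply/hasP; exists (last z p).
  by rewrite -lz lX in zX.
case: (split_find hX) pP pU => t q p2 Xt qX.
rewrite cat_path -cat_cons cat_uniq => /andP [pt _] /andP [+ _].
rewrite -rcons_cons rcons_uniq => /andP [_ u].
by exists q, t; split=> //=; rewrite negb_or zX.
Qed.

Lemma path_avoid (T : finType) (e : rel T) v z p :
  path (fun a b => [&& e a b, a != v & b != v]) z p -> path e z p && all (predC1 v) p.
Proof.
by elim: p z => //= a p IH z /andP [/and3P [-> _ ->] /IH].
Qed.

Lemma notin_ex (T : finType) (s : seq T) : size s < #|T| -> exists z, z \notin s.
Proof.
move=> lt; apply/existsP; apply: contraLR lt; rewrite negb_exists -leqNgt => /forallP h.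
by apply: leq_trans (card_size s); apply: subset_leq_card; apply/subsetP => x _;
   move: (h x); rewrite negbK.
Qed.

(** * Ears of a vertex set *)

Section Ears.
Variables (T : finType) (e : rel T).
Hypothesis (sym_e : symmetric e).

Lemma path_flip u p w : path e u (rcons p w) -> path e w (rcons (rev p) u).
Proof.
move=> h; have := rev_path e u (rcons p w).
rewrite last_rcons belast_rcons rev_cons => ->.
by rewrite (eq_path (e' := e)) // => x y; rewrite sym_e.
Qed.

Lemma path_rcons_cons u p y q w :
  path e u (rcons (p ++ y :: q) w) = path e u (rcons p y) && path e y (rcons q w).
Proof. by rewrite rcons_cat rcons_cons -cat_rcons cat_path last_rcons. Qed.

(** [p] lists only the inner vertices, so an edge between two vertices of [S] is an ear with empty
    [p]; where this must be excluded, [0 < size p] is demanded separately. *)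
Definition ear (S : pred T) u p w :=
  [/\ S u && S w, u != w, path e u (rcons p w), uniq p & ~~ has S p].

Lemma ear_rev (S : pred T) u p w : ear S u p w -> ear S w (rev p) u.
Proof.
case=> /andP [Su Sw] uw /path_flip pp up hp.
by split; rewrite ?Su ?Sw ?rev_uniq ?has_rev // eq_sym.
Qed.

(** Only the part of the walk from [x] on is shortened, so [x] survives and the ear has an inner
    vertex. *)
Lemma ear_shorten (S : pred T) u x q s : S u -> S s -> u != s ->
  path e u (rcons (x :: q) s) -> ~~ has S (x :: q) ->
  exists2 p, ear S u p s & 0 < size p.
Proof.
move=> Su Ss us; rewrite rcons_cons /= rcons_path => /and3P [eux qP els].
case: (shortenP qP) els => q' q'P q'U sub els.
rewrite negb_or => /andP [xS qS]; exists (x :: q') => //.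
split; rewrite ?Su ?Ss //; first by rewrite rcons_cons /= rcons_path eux q'P.
rewrite /= negb_or xS /=; apply: contra qS => /hasP [y /sub yq Sy].
by apply/hasP; exists y.
Qed.

(** Follow the first ear from [u] to the common vertex [y], then the second one backwards to [s],
    and shorten the resulting walk. *)
Lemma ear_join (S : pred T) u p w s p' t y :
  ear S u p w -> ear S s p' t -> y \in p -> y \in p' -> u != s ->
  exists2 q, ear S u q s & 0 < size q.
Proof.
case=> /andP [Su _] _ pP _ pS [] /andP [Ss _] _ p'P _ p'S yp yp' us.
case/splitPr: yp pP pS => p1 p2; rewrite path_rcons_cons => /andP [pP _].
rewrite has_cat /= !negb_or => /and3P [p1S yS _].
case/splitPr: yp' p'P p'S => q1 q2; rewrite path_rcons_cons => /andP [/path_flip qP _].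
rewrite has_cat negb_or => /andP [q1S _].
have P1 : path e u (rcons (p1 ++ y :: rev q1) s) by rewrite path_rcons_cons pP.
have H1 : ~~ has S (p1 ++ y :: rev q1) by rewrite has_cat /= has_rev !negb_or p1S yS.
by case: (p1 ++ y :: rev q1) P1 H1 (size_cat p1 (y :: rev q1)) => [|x q P1 H1 _];
   [rewrite /= addnS | apply: ear_shorten P1 H1].
Qed.

(** Leave the ear at [y] towards [z] and follow [q] to [t]. If [t] is in [S], the new ear stops
    there; if [t] is on the old ear, the detour replaces the stretch between [y] and [t]. *)
Lemma ear_extend (S : pred T) u p w y z q t :
  ear S u p w -> y \in p -> e y z -> ~~ S z -> z \notin p ->
  path e z (rcons q t) -> uniq (z :: q) -> ~~ has [predU S & mem p] (z :: q) ->
  S t || (t \in p) -> t != y ->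
  exists u' p' w', ear S u' p' w' /\ z \in p'.
Proof.
move=> E yp; move: E; case/splitPr: yp => p1 p2 E yz zS zp qP zqU zqX tX ty.
have {zqX} [zqS zqp] : ~~ has S (z :: q) /\ ~~ has (mem (p1 ++ y :: p2)) (z :: q).
  by move: zqX; rewrite has_predU negb_or => /andP.
(* Reversing the ear exchanges [u] with [w] and [p1] with [p2]; this covers [t = u] and [t] lying
   before [y]. *)
wlog : u p1 p2 w E zp zqp tX / (S t && (t != u)) || (t \in p2).
  move=> W; case: (boolP ((S t && (t != u)) || (t \in p2))) => [|N].
    exact: (W u p1 p2 w).
  have rE : rev (p1 ++ y :: p2) = rev p2 ++ y :: rev p1.
    by rewrite rev_cat rev_cons cat_rcons.
  have EE : p1 ++ y :: p2 =i rev p2 ++ y :: rev p1 by move=> x; rewrite -rE mem_rev.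
  apply: (W w (rev p2) (rev p1) u); rewrite -?EE //.
  - by rewrite -rE; apply: ear_rev.
  - by rewrite -(eq_has EE).
  case: E => _ uw _ _ _; move: N tX; rewrite !negb_or negb_and mem_cat inE (negPf ty) /=.
  rewrite mem_rev => /andP [N /negPf ->]; rewrite orbF => /orP [St|-> //]; last by rewrite orbT.
  by move: N; rewrite St /= => /negPn /eqP ->; rewrite uw.
case: E => /andP [Su Sw] uw.
rewrite path_rcons_cons has_cat cat_uniq /= !negb_or.
move=> /andP [P1 P2] /and3P [U1 /andP [yp1 dp] /andP [yp2 U2]] /and3P [p1S yS p2S].
move: zqp; rewrite -[has _ _]/(has (mem (p1 ++ y :: p2)) (z :: q)) => zqp.
have D1 : ~~ has (mem p1) (z :: q).
  by apply: contra zqp => /hasP [x xq xp]; apply/hasP; exists x => //=;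
    rewrite mem_cat (xp : x \in p1).
have D2 : forall x, x \in p2 -> x \notin z :: q.
  by move=> x xp; apply: contra zqp => xq; apply/hasP; exists x => //=;
    rewrite mem_cat inE xp !orbT.
have D3 : y \notin z :: q.
  by apply: contra zqp => yq; apply/hasP; exists y => //=; rewrite mem_cat inE eqxx orbT.
have base : uniq (p1 ++ y :: z :: q).
  rewrite cat_uniq U1 cons_uniq D3 zqU /= !negb_or yp1 /= !andbT.
  by move: D1; rewrite /= negb_or.
have baseS : ~~ has S (p1 ++ y :: z :: q).
  by rewrite has_cat negb_or p1S; move: zqS; rewrite /= !negb_or yS.
case/orP=> [/andP [St tu]|tp2].
  exists u, (p1 ++ y :: z :: q), t; split; last by rewrite mem_cat !inE eqxx !orbT.
  split=> //; rewrite ?Su ?St // 1?eq_sym //.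
  by rewrite path_rcons_cons P1 /= yz.
move: P2 yp2 U2 p2S D2 dp; case/splitPr: tp2 => r1 r2.
rewrite path_rcons_cons => /andP [_ P2] yp2.
rewrite cat_uniq cons_uniq => /and3P [_ _ /andP [tr2 U2]].
rewrite has_cat /= !negb_or => /and3P [_ St r2S] D2 dp.
exists u, ((p1 ++ y :: z :: q) ++ t :: r2), w; split; last first.
  by rewrite !mem_cat !inE eqxx !orbT.
split; rewrite ?Su ?Sw //.
- by rewrite -catA !cat_cons path_rcons_cons P1 /= yz path_rcons_cons qP.
- rewrite cat_uniq base /= tr2 U2 andbT.
  have sub : {subset t :: r2 <= r1 ++ t :: r2} by move=> x xr; rewrite mem_cat xr orbT.
  rewrite andbT -[_ || _]/(has (mem (p1 ++ y :: z :: q)) (t :: r2)).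
  apply/negP => /hasP [x /sub xr /=]; rewrite mem_cat inE => /or3P [xp|/eqP xy|xq].
  + by move/negP: dp; apply; apply/hasP; exists x.
  + by move: yp2; rewrite -xy xr.
  + by move/negP: (D2 x xr).
- by rewrite has_cat negb_or baseS /= negb_or St.
Qed.

Hypothesis tc : two_connected e.

(* The set of vertices lying in [S] or on an ear is closed under adjacency. *)
Lemma ear_through (S : pred T) a b z : S a -> S b -> a != b -> ~~ S z ->
  exists u p w, ear S u p w /\ z \in p.
Proof.
case: tc => _ con con' Sa Sb ab zS.
pose P y := S y \/ exists u p w, ear S u p w /\ y \in p.
suff: P z by case=> // Sz; rewrite Sz in zS.
have step y x : P y -> e y x -> P x.
  move=> Py yx; case: (boolP (S x)) => [Sx|xS]; [by left | right].
  case: Py => [Sy|[u [p [w [E yp]]]]].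
    have [s Ss sy] : exists2 s, S s & s != y.
      by case: (eqVneq a y) => [<-|]; [exists b; rewrite // eq_sym | exists a].
    have xy : x != y by apply: contraNneq xS => ->.
    (* Returning from [x] to [S] in the graph without [y] makes the ends [y] and [t] of the new ear
       distinct. *)
    have [q [t [qP qU qS St]]] := first_hit (con' y x s xy sy) xS Ss.
    have /andP [qP' /allP qy] := path_avoid qP.
    have ty : t != y by apply: qy; rewrite mem_rcons mem_head.
    exists y, (x :: q), t; split; last exact: mem_head.
    by split; rewrite ?Sy ?St // 1?eq_sym // rcons_cons /= yx.
  case: (boolP (x \in p)) => xp; first by exists u, p, w.
  have yS : ~~ S y by case: E => _ _ _ _; apply: contra => Sy; apply/hasP; exists y.
  have Su : S u by case: E => /andP [].
  have xy : x != y by apply: contraNneq xp => ->.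
  have uy : u != y by apply: contraNneq yS => <-.
  have xX : ~~ [predU S & mem p] x by apply/norP.
  have uX : [predU S & mem p] u by apply/orP; left.
  (* Here [y] is an inner vertex of an ear that misses [x]; the return path avoids [y] and stops on
     reaching [S] or that ear. *)
  have [q [t [qP qU qS tX]]] := first_hit (con' y x u xy uy) xX uX.
  have /andP [qP' /allP qy] := path_avoid qP.
  have ty : t != y by apply: qy; rewrite mem_rcons mem_head.
  exact: (ear_extend E yp yx xS xp qP').
have /connectP [p pP ->] := con a z.
have : P a by left.
by elim: p a pP {Sa ab zS} => //= x p IH a /andP [ax xp] Pa; apply: (IH x xp); apply: step ax.
Qed.

End Ears.

(** Turns distinctness in concatenations of possibly reversed segments into linear inequalities
    between multiplicities, within reach of [lia]. *)
Lemma uniq_countP (T : eqType) (s : seq T) : uniq s <-> forall x, count_mem x s <= 1.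
Proof.
split=> [u x|h]; first by rewrite count_uniq_mem // leq_b1.
apply: count_mem_uniq => x; move: (h x) (has_pred1 x s); rewrite has_count.
by case: (count_mem x s) => [|[|]] // _ <-.
Qed.

Lemma split_nth (T : Type) (x0 : T) (s : seq T) i : i < size s ->
  exists s1 s2, s = s1 ++ nth x0 s i :: s2 /\ size s1 = i.
Proof.
by move=> lt; exists (take i s), (drop i.+1 s); rewrite -drop_nth // cat_take_drop size_takel // ltnW.
Qed.

(** * Cycles made from a cycle and its ears *)

Section EarCycles.
Variables (T : finType) (e : rel T).
Hypothesis (sym_e : symmetric e).

Lemma two_paths_cycle u w p q :
  path e u (rcons p w) -> path e w (rcons q u) -> uniq (u :: p ++ w :: q) ->
  0 < size p + size q -> is_cycle e (u :: p ++ w :: q).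
Proof.
move=> pP qP U lt; split=> //; first by rewrite /= size_cat /=; lia.
by rewrite /= path_rcons_cons pP.
Qed.

Lemma is_cycle_rot n c : is_cycle e c -> is_cycle e (rot n c).
Proof. by case=> U s cP; split; rewrite ?rot_uniq ?size_rot ?rot_cycle. Qed.

Lemma ear_uniq (c p : seq T) u w : uniq c -> ear e (mem c) u p w -> uniq (c ++ p).
Proof. by move=> U [_ _ _ pU pS]; rewrite cat_uniq U pU pS. Qed.

(** The second arc wraps around the end of the sequence, so both arcs are read off the rotation of
    [c] that starts at position [i]. *)
Lemma cycle_split2 c x0 i j : is_cycle e c -> i < j -> j < size c ->
  exists q1 q2, [/\ path e (nth x0 c i) (rcons q1 (nth x0 c j)),
    path e (nth x0 c j) (rcons q2 (nth x0 c i)),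
    perm_eq c (nth x0 c i :: q1 ++ nth x0 c j :: q2),
    size q1 = j - i.+1 & size q2 = size c - (j - i).+1].
Proof.
move=> cC ij jc; have [s1 [s2 [ec es]]] := split_nth x0 jc.
have ui : nth x0 c i = nth x0 s1 i by rewrite ec nth_cat es ij.
have [|s3 [s4 []]] := @split_nth _ x0 s1 i; first by rewrite es.
rewrite -ui; move: (nth x0 c i) (nth x0 c j) ec => u w ec es1 es3.
have [_ _] := is_cycle_rot (size s3) cC.
have rE : rot (size s3) c = u :: s4 ++ w :: (s2 ++ s3).
  by rewrite ec es1 -!catA rot_size_cat /= -!catA.
rewrite rE /= path_rcons_cons => /andP [P1 P2].
exists s4, (s2 ++ s3); split=> //; first by rewrite -rE perm_sym perm_rot.
  by move: (f_equal size es1); rewrite size_cat /=; lia.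
move: (f_equal size ec) (f_equal size es1); rewrite !size_cat /=; lia.
Qed.

(** The ear closes up with either arc of [c]: [c1] keeps the arc with [j - i] edges, [c2] the
    complementary one. *)
Lemma ear_cycles c x0 i j p : is_cycle e c -> i < j -> j < size c ->
  ear e (mem c) (nth x0 c i) p (nth x0 c j) -> 0 < size p ->
  exists c1 c2, [/\ is_cycle e c1, is_cycle e c2,
   {subset p <= c1} /\ {subset p <= c2},
   size c1 = j - i + (size p).+1 & size c2 = size c - (j - i) + (size p).+1].
Proof.
move=> cC ij jc E sp; have [cU _ _] := cC.
have /uniq_countP U := ear_uniq cU E.
have [q1 [q2 [P1 P2 /permP pe s1 s2]]] := cycle_split2 x0 cC ij jc.
case: E => _ _; move: (nth x0 c i) (nth x0 c j) P1 P2 pe => u w P1 P2 pe P _ _.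
exists (u :: p ++ w :: rev q1), (u :: p ++ w :: q2); split.
- apply: two_paths_cycle => //; [exact: path_flip| |lia].
  apply/uniq_countP => x; move: (U x) (pe (pred1 x)).
  by rewrite /= !count_cat /= count_rev; lia.
- apply: two_paths_cycle => //; last lia.
  apply/uniq_countP => x; move: (U x) (pe (pred1 x)).
  by rewrite /= !count_cat /=; lia.
- by split=> x xp; rewrite inE mem_cat xp orbT.
- rewrite /= size_cat /= size_rev; lia.
- rewrite /= size_cat /=; lia.
Qed.

(** The four ends cut [c] into four arcs. Both ears together with two opposite arcs form a cycle,
    for each of the two choices, so the two lengths add up to [size c] plus twice the number of
    edges of the ears. *)
Lemma crossing_cycles c x0 i i' j j' p p' : is_cycle e c ->
  i < i' -> i' < j -> j < j' -> j' < size c ->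
  ear e (mem c) (nth x0 c i) p (nth x0 c j) ->
  ear e (mem c) (nth x0 c i') p' (nth x0 c j') ->
  (forall x, x \in p -> x \notin p') ->
  exists c1 c2, [/\ is_cycle e c1, is_cycle e c2,
   {subset p <= c1} /\ {subset p <= c2},
   size c1 = (i' - i) + (j' - j) + (size p + size p').+2 &
   size c2 = (size c - (j' - i)) + (j - i') + (size p + size p').+2].
Proof.
move=> cC ii ij jj jc E E' D; have [cU _ _] := cC.
have U : uniq (c ++ p ++ p').
  have := ear_uniq cU E; have := ear_uniq cU E'.
  rewrite !cat_uniq has_cat negb_or => /and3P [_ h' ->] /and3P [-> h ->].
  by rewrite h' !andbT h /=; apply/hasPn => x xp; apply: contraL xp => /D.
move/uniq_countP: U => U.
have [s1 [s2 [ec es]]] := split_nth x0 jc.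
have uj : nth x0 c j = nth x0 s1 j by rewrite ec nth_cat es jj.
have ui' : nth x0 c i' = nth x0 s1 i' by rewrite ec nth_cat es (ltn_trans ij jj).
have lji : i < j' by lia.
have ui : nth x0 c i = nth x0 s1 i by rewrite ec nth_cat es lji.
have [|s3 [s4 [es1 es3]]] := @split_nth _ x0 s1 j; first by rewrite es.
have vi' : nth x0 s1 i' = nth x0 s3 i' by rewrite es1 nth_cat es3 ij.
have lij : i < j by lia.
have vi : nth x0 s1 i = nth x0 s3 i by rewrite es1 nth_cat es3 lij.
have [|s5 [s6 [es2 es5]]] := @split_nth _ x0 s3 i'; first by rewrite es3.
have wi : nth x0 s3 i = nth x0 s5 i by rewrite es2 nth_cat es5 ii.
have [|s7 [s8 [es4 es7]]] := @split_nth _ x0 s5 i; first by rewrite es5.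
move: E E' ec es1 es2 es4; rewrite -wi -vi -vi' -ui -ui' -uj.
move: (nth x0 c i) (nth x0 c j) (nth x0 c i') (nth x0 c j') => u w s t.
move=> {ui ui' uj vi vi' wi} [_ _ P _ _] [_ _ P' _ _] ec es1 es2 es4.
have [_ _] := is_cycle_rot (size s7) cC.
(* Around [c] the ends come in the order [u], [s], [w], [t]; the arcs between them are [s8], [s6],
   [s4] and the wrapping [s2 ++ s7]. *)
have rE : rot (size s7) c = u :: s8 ++ s :: s6 ++ w :: s4 ++ t :: (s2 ++ s7).
  by rewrite ec es1 es2 es4 -!catA rot_size_cat /= -!catA /= -!catA /= -!catA.
have pe x : count x c = count x (rot (size s7) c).
  by apply/permP; rewrite perm_sym perm_rot.
have sz := size_rot (size s7) c.
rewrite rE in pe sz *; rewrite /= !path_rcons_cons => /and4P [P1 P2 P3 P4].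
have z8 : size s8 = i' - i.+1.
  by move: (f_equal size es4); rewrite size_cat /=; lia.
have z6 : size s6 = j - i'.+1.
  by move: (f_equal size es2); rewrite size_cat /=; lia.
have z4 : size s4 = j' - j.+1.
  by move: (f_equal size es1); rewrite size_cat /=; lia.
exists (u :: p ++ w :: (s4 ++ t :: (rev p' ++ s :: rev s8))).
exists (u :: p ++ w :: (rev s6 ++ s :: (p' ++ t :: (s2 ++ s7)))).
split.
- apply: two_paths_cycle => //.
  + by rewrite !path_rcons_cons P3 !path_flip.
  + apply/uniq_countP => x; move: (U x) (pe (pred1 x)).
    do 6! rewrite ?(count_cat, count_rev) /=.
    move: (nat_of_bool (u == x)) (nat_of_bool (s == x)) => nu ns.
    move: (nat_of_bool (w == x)) (nat_of_bool (t == x)) => nw nt.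
    by clear; lia.
  + by rewrite !size_cat /= addnA addnS.
- apply: two_paths_cycle => //.
  + by rewrite !path_rcons_cons P' P4 !path_flip.
  + apply/uniq_countP => x; move: (U x) (pe (pred1 x)).
    do 6! rewrite ?(count_cat, count_rev) /=.
    move: (nat_of_bool (u == x)) (nat_of_bool (s == x)) => nu ns.
    move: (nat_of_bool (w == x)) (nat_of_bool (t == x)) => nw nt.
    by clear; lia.
  + by rewrite !size_cat /= !addnS.
- by split=> x xp; rewrite inE mem_cat xp orbT.
- by do 6! rewrite ?(size_cat, size_rev) /=; lia.
- by move: sz; do 6! rewrite ?(size_cat, size_rev) /=; lia.
Qed.

End EarCycles.

(** * Constraints on the ears of a longest cycle *)

Section LowerBound.
Variables (T : finType) (e : rel T).
Hypothesis (simple_e : simple_graph e).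
Let sym_e : symmetric e := simple_e.1.

(** Take an edge [a y] and a third vertex: an ear of the pair of ends through that vertex closes up
    with the edge. *)
Lemma two_connected_cycle : two_connected e -> exists c, is_cycle e c.
Proof.
move=> tc; have [card_T con _] := tc.
have /card_gt0P [a _] : 0 < #|T| by apply: leq_trans card_T.
have [b ba] : exists b, b \notin [:: a] by apply: notin_ex; apply: leq_trans card_T.
have [y ay] : exists y, e a y.
  case/connectP: (con a b) => -[|y p] /=; last by case/andP; exists y.
  by move=> _ E; rewrite E inE eqxx in ba.
have nay : a != y by apply: contraTneq ay => <-; rewrite simple_e.2.
have [z] : exists z, z \notin [:: a; y] by apply: notin_ex.
move=> zS; have [u [p [w [[/andP [Su Sw] uw P U H] zp]]]] :=
  @ear_through T e sym_e tc (mem [:: a; y]) a y z (mem_head _ _) (mem_last _ [:: y]) nay zS.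
exists (u :: p ++ w :: [::]); apply: two_paths_cycle => //.
- rewrite /= andbT; move: Su Sw uw; rewrite /= !inE.
  by move=> /orP [] /eqP -> /orP [] /eqP ->; rewrite ?eqxx // 1?sym_e // => _; rewrite sym_e.
- apply/uniq_countP => x; have : uniq ([:: u; w] ++ p).
    rewrite cat_uniq U /= inE uw /= andbT; apply: contra H => /hasP [v vp].
    rewrite /= !inE => vuw; apply/hasP; exists v => //.
    by case/orP: vuw => /eqP ->.
  move/uniq_countP => /(_ x); rewrite /= !count_cat /=.
  by move: (nat_of_bool (u == x)) (nat_of_bool (w == x)) => nu nw; clear; lia.
- by case: (p) zp.
Qed.

Lemma two_connected_cummerbund : two_connected e -> exists c, cummerbund e c.
Proof.
case/two_connected_cycle => c.
elim: {c}_.+1 {-2}c (ltnSn (#|T| - size c)) => // m IH c lt cC.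
case: (classic (exists2 c', is_cycle e c' & size c < size c')) => [[c' c'C ltc]|N].
  apply: (IH c') => //; have [U _ _] := c'C.
  have := max_card [in c']; rewrite (card_uniqP U); lia.
exists c; split=> // c' c'C; rewrite leqNgt; apply/negP => ltc.
by apply: N; exists c'.
Qed.

Lemma in_cummerbundP v : reflect (in_some_cummerbund e v) (in_some_cummerbundb e v).
Proof. by rewrite /in_some_cummerbundb; case: excluded_middle_informative; constructor. Qed.

Lemma leq_cc (s : seq T) : uniq s -> (forall v, v \in s -> in_some_cummerbund e v) ->
  size s <= cc e.
Proof.
move=> U sC; rewrite -(card_uniqP U); apply: subset_leq_card.
by apply/subsetP => v vs; rewrite inE; apply/in_cummerbundP/sC.
Qed.

Variables (c : seq T) (g : nat).
Hypothesis (tc : two_connected e) (cumm_c : cummerbund e c) (girth_e : girth_at_least e g).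

Lemma cc_ge_size : size c <= cc e.
Proof. by apply: leq_cc => [|v vc]; [case: cumm_c => [[]] | exists c]. Qed.

Lemma girth_cummerbund : g <= size c.
Proof. by apply: girth_e; case: cumm_c. Qed.

Lemma cc_ge_ear u p w : ear e (mem c) u p w ->
  (forall v, v \in p -> in_some_cummerbund e v) -> size c + size p <= cc e.
Proof.
move=> E pC; rewrite -size_cat; apply: leq_cc.
  by apply: ear_uniq E; case: cumm_c => [[]].
by move=> v; rewrite mem_cat => /orP [vc|/pC //]; exists c.
Qed.

Lemma cc_all : (forall v, v \notin c -> in_some_cummerbund e v) -> cc e = #|T|.
Proof.
move=> h; apply/eqP; rewrite eqn_leq max_card -{1}cardsT /=.
apply: subset_leq_card; apply/subsetP => v _; rewrite inE; apply/in_cummerbundP.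
by case: (boolP (v \in c)) => [vc|/h //]; exists c.
Qed.

Variable x0 : T.

Lemma ear_through_index z : z \notin c -> exists i j p,
  [/\ i < j, j < size c, ear e (mem c) (nth x0 c i) p (nth x0 c j) & z \in p].
Proof.
move=> zc; have [[U s3 _] _] := cumm_c.
have c1 : 1 < size c by apply: ltnW.
have n01 : nth x0 c 0 != nth x0 c 1 by rewrite nth_uniq // ltnW.
have m0 : nth x0 c 0 \in c by rewrite mem_nth // ltnW.
have m1 : nth x0 c 1 \in c by apply: mem_nth.
have [u [p [w [E zp]]]] := @ear_through T e sym_e tc (mem c) _ _ z m0 m1 n01 zc.
have [/andP [/= uc wc] uw _ _ _] := E.
rewrite -(nth_index x0 uc) -(nth_index x0 wc) in E uw.
have iu : index u c < size c by rewrite index_mem.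
have iw : index w c < size c by rewrite index_mem.
case: (ltngtP (index u c) (index w c)) => [lt|lt|eq]; last by rewrite eq eqxx in uw.
  by exists (index u c), (index w c), p.
exists (index w c), (index u c), (rev p); split; rewrite ?mem_rev //.
exact: ear_rev.
Qed.

(** Both cycles of [ear_cycles] are at most as long as [c] and at least as long as the girth.
    Equality in one of the first two bounds means that one of them is a longest cycle, and it
    contains [p]. *)
Lemma ear_bounds i j p : i < j -> j < size c ->
  ear e (mem c) (nth x0 c i) p (nth x0 c j) -> 0 < size p ->
  [/\ size p < j - i, j - i + size p < size c,
      g <= j - i + (size p).+1, g <= size c - (j - i) + (size p).+1 &
      size p = (j - i).-1 \/ j - i + (size p).+1 = size c -> size c + size p <= cc e].
Proof.
move=> ij jc E sp; have [cC cmax] := cumm_c.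
have [c1 [c2 [C1 C2 [sub1 sub2] z1 z2]]] := ear_cycles sym_e cC ij jc E sp.
have := girth_e C1; have := girth_e C2; have := cmax _ C1; have := cmax _ C2.
rewrite z1 z2 => h1 h2 g1 g2; split; try lia.
move=> h; apply: cc_ge_ear E _ => v vp.
case: h => h; [exists c2 | exists c1]; (split; last by auto); split=> // c' /cmax; lia.
Qed.

Lemma ear_in_cummerbund i j p v : i < j -> j < size c ->
  ear e (mem c) (nth x0 c i) p (nth x0 c j) -> v \in p ->
  size p = (j - i).-1 \/ j - i + (size p).+1 = size c -> in_some_cummerbund e v.
Proof.
move=> ij jc E vp h; have [cC cmax] := cumm_c.
have sp : 0 < size p by case: (p) vp.
have [c1 [c2 [C1 C2 [sub1 sub2] z1 z2]]] := ear_cycles sym_e cC ij jc E sp.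
by case: h => h; [exists c2 | exists c1]; (split; last by auto); split=> // c' /cmax; lia.
Qed.

(** The ears have at least four edges in all, so the two crossing cycles have total length at least
    [size c + 8], but at most [2 * size c]. Hence [size c] is 8, both cycles are longest, and [p]
    adds vertices to those of [c]. *)
Lemma crossing_bound i j p i' j' p' : i < i' -> i' < j -> j < j' -> j' < size c ->
  ear e (mem c) (nth x0 c i) p (nth x0 c j) ->
  ear e (mem c) (nth x0 c i') p' (nth x0 c j') ->
  (forall x, x \in p -> x \notin p') -> 0 < size p -> 0 < size p' ->
  size c <= 8 -> size c = 8 /\ 8 < cc e.
Proof.
move=> ii ij jj jc E E' D sp sp' c8; have [cC cmax] := cumm_c.
have [c1 [c2 [C1 C2 [sub1 sub2] z1 z2]]] := crossing_cycles sym_e cC ii ij jj jc E E' D.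
have h1 := cmax _ C1; have h2 := cmax _ C2; split; first lia.
have : size c + size p <= cc e; last lia.
apply: cc_ge_ear E _ => v vp.
case: (ltnP (size c1) (size c)) => h; [exists c2 | exists c1]; (split; last by auto); split=> // c' /cmax; lia.
Qed.

(** The two ears form a cycle that meets [c] only in [u] and [w]. *)
Lemma parallel_ears u w p p' : ear e (mem c) u p w -> ear e (mem c) u p' w ->
  (forall x, x \in p -> x \notin p') -> 0 < size p -> g <= size p + size p' + 2.
Proof.
move=> E E' D sp; have [cC _] := cumm_c; have [U _ _] := cC.
have [/andP [uc wc] uw P pU _] := E; have [_ _ P' pU' _] := E'.
have cyc : is_cycle e (u :: p ++ w :: rev p').
  apply: two_paths_cycle => //; [exact: path_flip| |lia].
  have := ear_uniq U E; have := ear_uniq U E'; rewrite !cat_uniq.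
  move=> /and3P [_ /hasPn h' _] /and3P [_ /hasPn h _].
  have np x : x \in c -> x \notin p by move=> xc; apply/negP => /h; rewrite /= xc.
  have np' x : x \in c -> x \notin p' by move=> xc; apply/negP => /h'; rewrite /= xc.
  rewrite cons_uniq mem_cat inE mem_rev cat_uniq cons_uniq rev_uniq mem_rev pU pU'.
  rewrite (negPf (np _ uc)) (negPf (np' _ uc)) (negPf uw) (negPf (np' _ wc)) /= !andbT.
  apply/norP; split; first exact: np.
  by apply/hasPn => x /=; rewrite mem_rev; apply: contraL => /D.
by have := girth_e cyc; rewrite /= size_cat /= size_rev; lia.
Qed.

End LowerBound.

(* On a cycle of length [7] the chords at distance three are [{m, m + 3}], with
   [m] taken modulo [7]. *)
Definition chord k i j m := j < k /\ (j = i + 3 /\ m = i \/ j = i + 4 /\ m = j).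

(** Modulo 7, chords starting at [m] and [m'] coincide if [m' - m] is 0 and cross if it is 1, 2, 5
    or 6; only 3 and 4 remain. *)
Lemma chord_compat k i j m i' j' m' : k <= 7 -> chord k i j m -> chord k i' j' m' ->
  ~ (i < i' /\ i' < j /\ j < j') -> ~ (i' < i /\ i < j' /\ j' < j) ->
  ~ (i = i' /\ j = j') ->
  (m + 3 <= m' /\ m' <= m + 4) \/ (m' + 3 <= m /\ m <= m' + 4).
Proof.
by move=> k7 [jk [[? ?]|[? ?]]] [jk' [[? ?]|[? ?]]] c1 c2 c3; subst; lia.
Qed.

(** * Lower bounds for girth 4, 5 and 6 *)

Section Bounds.
Variables (T : finType) (e : rel T).
Hypotheses (simple_e : simple_graph e) (tc : two_connected e).
Let sym_e : symmetric e := simple_e.1.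

(** If the longest cycle has length 4 or 5, the bounds leave only ears that yield another longest
    cycle, so every vertex is counted. *)
Lemma cc_girth4 : girth_at_least e 4 -> 6 <= #|T| -> 6 <= cc e.
Proof.
move=> ge nT; have [c cumm_c] := two_connected_cummerbund simple_e tc.
have gc := girth_cummerbund cumm_c ge; have cc_c := cc_ge_size cumm_c.
case: (leqP 6 (size c)) => c6; first exact: leq_trans cc_c.
rewrite (cc_all cumm_c) // => z zc.
have [i [j [p [ij jc E zp]]]] := ear_through_index simple_e tc cumm_c z zc.
have sp : 0 < size p by case: (p) zp.
have [h1 h2 h3 h4 _] := ear_bounds simple_e cumm_c ge ij jc E sp.
by apply: (ear_in_cummerbund simple_e cumm_c ij jc E zp); lia.
Qed.

(** Otherwise the longest cycle has length at most 7 and misses three vertices. Each of these is the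
    only inner vertex of an ear, and three such ears do not fit together. *)
Lemma cc_girth5 : girth_at_least e 5 -> 10 <= #|T| -> 8 <= cc e.
Proof.
move=> ge nT; have [c cumm_c] := two_connected_cummerbund simple_e tc.
have gc := girth_cummerbund cumm_c ge; have cc_c := cc_ge_size cumm_c.
case: (leqP 8 (cc e)) => // cc8.
have c7 : size c <= 7 by apply: leq_trans cc_c _.
have new (s : seq T) : size s <= 9 -> exists z, z \notin s.
  by move=> s9; apply: notin_ex; apply: leq_trans nT.
have [z1 z1c] : exists z, z \notin c by apply: new; apply: leq_trans c7 _.
have [z2] : exists z, z \notin z1 :: c by apply: new; rewrite /= ltnS ltnW.
have [z3] : exists z, z \notin [:: z1, z2 & c] by apply: new; rewrite /= !ltnS.
rewrite !inE !negb_or => /and3P [z31 z32 z3c] /andP [z21 z2c].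
(* Two or more inner vertices would yield another longest cycle and raise [cc e] to 8. With one
   inner vertex, girth 5 forces both arcs between the ends to have at least three edges. *)
have short z : z \notin c -> exists i j,
    [/\ j < size c, 5 <= j - i + 2, 5 <= size c - (j - i) + 2, 6 <= size c &
        ear e (mem c) (nth z1 c i) [:: z] (nth z1 c j)].
  move=> zc; have [i [j [p [ij jc E zp]]]] := ear_through_index simple_e tc cumm_c z1 zc.
  have sp : 0 < size p by case: (p) zp.
  have [h1 h2 h3 h4 h5] := ear_bounds simple_e cumm_c ge ij jc E sp.
  have p1 : size p = 1.
    suff : ~ (2 <= size p) by lia.
    move=> p2; suff /h5 : size p = (j - i).-1 \/ j - i + (size p).+1 = size c by lia.
    by lia.
  rewrite p1 in h1 h2 h3 h4; exists i, j; split=> //; first lia.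
  by move: E zp; case: (p) p1 => // a [] //= _ E; rewrite inE => /eqP ->.
(* Crossing would require length 8, and two such ears with the same ends would form a 4-cycle. *)
have indep z z' i j i' j' : z != z' -> j < size c -> j' < size c ->
    ear e (mem c) (nth z1 c i) [:: z] (nth z1 c j) ->
    ear e (mem c) (nth z1 c i') [:: z'] (nth z1 c j') ->
    ~ (i < i' /\ i' < j /\ j < j') /\ ~ (i = i' /\ j = j').
  move=> zz' jc jc' E E'.
  have D x : x \in [:: z] -> x \notin [:: z'] by rewrite !inE => /eqP ->.
  split=> [[ii [ij jj]]|[ii jj]].
    by have [//|//||] := crossing_bound simple_e cumm_c ii ij jj jc' E E' D; lia.
  by rewrite -ii -jj in E'; have := parallel_ears simple_e cumm_c ge E E' D isT.
have chordP i j : j < size c -> 5 <= j - i + 2 -> 5 <= size c - (j - i) + 2 ->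
    exists m, chord (size c) i j m.
  move=> jc h1 h2; have [|] : j = i + 3 \/ j = i + 4 by lia.
    by exists i; split=> //; left.
  by exists j; split=> //; right.
have [i1 [j1 [jc1 a1 b1 c6 E1]]] := short _ z1c.
have [i2 [j2 [jc2 a2 b2 _ E2]]] := short _ z2c.
have [i3 [j3 [jc3 a3 b3 _ E3]]] := short _ z3c.
have [m1 ch1] := chordP _ _ jc1 a1 b1.
have [m2 ch2] := chordP _ _ jc2 a2 b2.
have [m3 ch3] := chordP _ _ jc3 a3 b3.
have sep z z' i j m i' j' m' : z != z' -> chord (size c) i j m -> chord (size c) i' j' m' ->
    ear e (mem c) (nth z1 c i) [:: z] (nth z1 c j) ->
    ear e (mem c) (nth z1 c i') [:: z'] (nth z1 c j') ->
    (m + 3 <= m' /\ m' <= m + 4) \/ (m' + 3 <= m /\ m <= m' + 4).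
  move=> zz' ch ch' E E'; have [jc _] := ch; have [jc' _] := ch'.
  have [n1 n2] := indep _ _ _ _ _ _ zz' jc jc' E E'.
  rewrite eq_sym in zz'; have [n3 _] := indep _ _ _ _ _ _ zz' jc' jc E' E.
  exact: (chord_compat c7 ch ch').
(* Three integers cannot pairwise differ by 3 or 4: the extreme ones would differ by at least 6. *)
have := sep _ _ _ _ _ _ _ _ z21 ch2 ch1 E2 E1.
have := sep _ _ _ _ _ _ _ _ z31 ch3 ch1 E3 E1.
have := sep _ _ _ _ _ _ _ _ z32 ch3 ch2 E3 E2.
clear; lia.
Qed.

(** On a cycle of length 6 or 7, girth 6 and maximality leave only ears that yield another longest
    cycle. *)
Lemma cc_girth6_cases c : girth_at_least e 6 -> cummerbund e c ->
  cc e = #|T| \/ 8 <= size c.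
Proof.
move=> ge cumm_c; have gc := girth_cummerbund cumm_c ge.
case: (leqP 8 (size c)) => c8; [by right | left].
rewrite (cc_all cumm_c) // => z zc.
have [i [j [p [ij jc E zp]]]] := ear_through_index simple_e tc cumm_c z zc.
have sp : 0 < size p by case: (p) zp.
have [h1 h2 h3 h4 _] := ear_bounds simple_e cumm_c ge ij jc E sp.
by apply: (ear_in_cummerbund simple_e cumm_c ij jc E zp); lia.
Qed.

Lemma cc_girth6 : girth_at_least e 6 -> 8 <= #|T| -> 8 <= cc e.
Proof.
move=> ge nT; have [c cumm_c] := two_connected_cummerbund simple_e tc.
case: (cc_girth6_cases ge cumm_c) => [->//|c8].
exact: leq_trans (cc_ge_size cumm_c).
Qed.

(** A function choosing related elements is injective on [A]; the default in [odflt] is never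
    reached there. *)
Lemma leq_card_rel (A B : {set T}) (r : rel T) :
  (forall a, a \in A -> exists2 b, b \in B & r a b) ->
  (forall a a' b, a \in A -> a' \in A -> b \in B -> r a b -> r a' b -> a = a') ->
  #|A| <= #|B|.
Proof.
move=> tot inj; pose f a := odflt a [pick b in B | r a b].
have fP a : a \in A -> f a \in B /\ r a (f a).
  rewrite /f => /tot [b bB ab]; case: pickP => [x /andP []|/(_ b)] //=.
  by rewrite bB ab.
rewrite -(@card_in_imset _ _ f A); last first.
  move=> a a' aA a'A ff; have [fB ra] := fP a aA; have [_ ra'] := fP a' a'A.
  by apply: (inj a a' (f a)) => //; rewrite ff.
by apply: subset_leq_card; apply/subsetP => _ /imsetP [a /fP [] ? _ ->].
Qed.

(* When every ear of the longest cycle [c] joins [u] to [w] and has one or two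
   inner vertices, girth 6 leaves only inner pairs, perfectly matched. *)
Lemma short_ears_even (c : seq T) u w : girth_at_least e 6 -> uniq c ->
  u \in c -> w \in c -> u != w -> (size c).+2 <= #|T| ->
  (forall z, z \notin c -> exists2 p, ear e (mem c) u p w & z \in p /\ size p <= 2) ->
  odd #|T| = odd (size c).
Proof.
move=> ge cU uc wc uw nT ears.
have cyc4 x y z t : e x y -> e y z -> e z t -> e t x -> x != z -> y != t -> False.
  move=> xy yz zt tx xz yt; suff /ge : is_cycle e [:: x; y; z; t] by [].
  have ne a b : e a b -> a != b by apply: contraTneq => ->; rewrite simple_e.2.
  split=> //=; last by rewrite xy yz zt tx.
  by rewrite !inE !negb_or xz yt (ne _ _ xy) (ne _ _ yz) (ne _ _ zt) eq_sym (ne _ _ tx).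
have cyc3 x y z : e x y -> e y z -> e z x -> False.
  move=> xy yz zx; suff /ge : is_cycle e [:: x; y; z] by [].
  have ne a b : e a b -> a != b by apply: contraTneq => ->; rewrite simple_e.2.
  split=> //=; last by rewrite xy yz zx.
  by rewrite !inE !negb_or (ne _ _ xy) (ne _ _ yz) eq_sym (ne _ _ zx).
have cases z : z \notin c -> (e u z /\ e z w) \/
   (exists2 y, y \notin c & (e u z /\ e z y /\ e y w) \/ (e u y /\ e y z /\ e z w)).
  move=> zc; have [p [_ _ P _ /hasPn H] [zp sp]] := ears z zc.
  case: p zp sp P H => [|a [|b []]] //=.
    by rewrite inE => /eqP <- _ /and3P [-> -> _] _; left.
  rewrite !inE => ab _ /and4P [ua ab' bw _] H; right.
  have Ha : a \notin c by apply: H; rewrite !inE eqxx.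
  have Hb : b \notin c by apply: H; rewrite !inE eqxx orbT.
  by case/orP: ab => /eqP ->; [exists b => //; left | exists a => //; right].
have nin a b : a \in c -> b \notin c -> a != b by move=> ac; apply: contraNneq => <-.
(* A second vertex off [c] lies on another ear from [u] to [w]; with the path through [x] this gives
   a cycle of length 3, 4 or 5. *)
have no1 x : x \notin c -> e u x -> e x w -> False.
  move=> xc ux xw; have [z] : exists z, z \notin x :: c by apply: notin_ex.
  rewrite inE negb_or => /andP [zx zc].
  have five y y' : y \notin c -> y' \notin c -> e u y -> e y y' -> e y' w -> False.
    move=> yc y'c uy yy' y'w.
    case: (eqVneq y x) => [eyx|yx].
      by subst y; apply: (cyc3 x y' w) => //; rewrite sym_e.
    case: (eqVneq y' x) => [eyx|y'x].
      by subst y'; apply: (cyc3 u y x) => //; rewrite sym_e.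
    have ne a b : e a b -> a != b by apply: contraTneq => ->; rewrite simple_e.2.
    suff /ge : is_cycle e [:: u; y; y'; w; x] by [].
    split=> //=; last by rewrite uy yy' y'w sym_e xw sym_e ux.
    rewrite !inE !negb_or uw yx y'x (nin u y) // (nin u y') // (nin u x) // (ne _ _ yy').
    by rewrite [y == w]eq_sym (nin w y) // [y' == w]eq_sym (nin w y') // (nin w x).
  case: (cases z zc) => [[uz zw]|[y yc [[uz [zy yw]]|[uy [yz zw]]]]].
  - by apply: (cyc4 u x w z) => //; [rewrite sym_e|rewrite sym_e|rewrite eq_sym].
  - exact: (five z y).
  - exact: (five y z).
(* By [cases] and [no1] the complement of [c] splits into the neighbours of [u] and those of [w].
   The ears match the two sets, and a vertex with two partners would lie on a 4-cycle through [u] or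
   [w]. *)
pose A := [set z | (z \notin c) && e u z]; pose B := [set z | (z \notin c) && e z w].
have dAB : [disjoint A & B].
  rewrite -setI_eq0; apply/eqP/setP => z; rewrite !inE.
  by apply/negP => /andP [/andP [zc uz] /andP [_ zw]]; apply: (no1 z).
have cAB : A :|: B = [set z | z \notin c].
  apply/setP => z; rewrite !inE -andb_orr.
  case: (boolP (z \in c)) => //= zc.
  by case: (cases z zc) => [[-> _]|[y _ [[-> _]|[_ [_ ->]]]]] //; rewrite orbT.
have AB : #|A| <= #|B|.
  apply: (@leq_card_rel _ _ e) => [a|a a' b]; rewrite !inE.
    case/andP => ac ua; case: (cases a ac) => [[_ /(no1 a ac ua)]//|[y yc]].
    case=> [[_ [ay yw]]|[_ [_ /(no1 a ac ua)]]] //.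
    by exists y; rewrite // inE yc.
  move=> /andP [ac ua] /andP [_ ua'] /andP [bc _] ab a'b; apply/eqP/negPn/negP => aa'.
  by apply: (cyc4 u a b a') => //; [rewrite sym_e|rewrite sym_e|apply: nin].
have BA : #|B| <= #|A|.
  apply: (@leq_card_rel _ _ e) => [a|a a' b]; rewrite !inE.
    case/andP => ac ua; case: (cases a ac) => [[/(no1 a ac) h /h]//|[y yc]].
    case=> [[/(no1 a ac) h _]|[uy [ya _]]]; first by case: h.
    by exists y; rewrite ?inE ?yc // sym_e.
  move=> /andP [ac ua] /andP [_ ua'] /andP [bc _] ab a'b; apply/eqP/negPn/negP => aa'.
  by apply: (cyc4 w a b a') => //; [rewrite sym_e|rewrite sym_e|apply: nin].
have := cardC (mem c); rewrite (card_uniqP cU) => <-.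
have -> : #|[predC c]| = #|A :|: B| by rewrite cAB cardsE; apply: eq_card.
have /eqP -> : #|A :|: B| == #|A| + #|B| by rewrite (leq_card_setU A B).2.
have /eqP -> : #|B| == #|A| by rewrite eqn_leq BA AB.
by rewrite oddD addnn odd_double addbF.
Qed.

(** If [cc e] is at most 8, then [c] has length 8 and no ear yields another longest cycle. This
    forces all ears to share one antipodal pair of ends, and [short_ears_even] contradicts the odd
    order. *)
Lemma cc_girth6_odd : girth_at_least e 6 -> 10 <= #|T| -> odd #|T| -> 9 <= cc e.
Proof.
move=> ge nT oT; have [c cumm_c] := two_connected_cummerbund simple_e tc.
case: (cc_girth6_cases ge cumm_c) => [->|c8]; first exact: leq_trans nT.
have cc_c := cc_ge_size cumm_c.
case: (leqP 9 (cc e)) => // cc9.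
have {}c8 : size c = 8 by apply/eqP; rewrite eqn_leq c8 andbT (leq_trans cc_c).
have [cU _ _] := proj1 cumm_c.
have [x0 x0c] : exists z, z \notin c by apply: notin_ex; rewrite c8; apply: leq_trans nT.
have bnd i j p : i < j -> j < size c -> ear e (mem c) (nth x0 c i) p (nth x0 c j) ->
    0 < size p -> j = i + 4 /\ size p <= 2.
  move=> ij jc E sp.
  have [h1 h2 h3 h4 h5] := ear_bounds simple_e cumm_c ge ij jc E sp.
  suff : ~ (size p = (j - i).-1 \/ j - i + (size p).+1 = size c) by lia.
  by move/h5; lia.
have [i [j [p [ij jc E xp]]]] := ear_through_index simple_e tc cumm_c x0 x0c.
have sp : 0 < size p by case: (p) xp.
have [ei p2] := bnd _ _ _ ij jc E sp.
have same i' j' p' : i' < j' -> j' < size c ->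
    ear e (mem c) (nth x0 c i') p' (nth x0 c j') -> 0 < size p' -> i' = i.
  move=> ij' jc' E' sp'; have [ei' p2'] := bnd _ _ _ ij' jc' E' sp'.
  apply/eqP/negPn/negP => ii'.
  (* Ears with a common inner vertex join to an ear between positions [i] and [i'], both below 4 and
     hence not antipodal. Disjoint ears with different antipodal ends cross, which gives
     [8 < cc e]. *)
  case: (boolP (has (mem p) p')) => [/hasP [y yp' yp]|N].
    have uu : nth x0 c i' != nth x0 c i by rewrite nth_uniq //; apply: ltn_trans; eassumption.
    have [q Q sq] := ear_join sym_e E' E yp' yp uu.
    case: (ltngtP i' i) => lt; last by rewrite lt eqxx in ii'.
      have [h _] := bnd _ _ _ lt (ltn_trans ij jc) Q sq; lia.
    have [|h _] := bnd _ _ _ lt (ltn_trans ij' jc') (ear_rev sym_e Q); first by rewrite size_rev.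
    lia.
  have D y : y \in p' -> y \notin p by move=> yp; apply: contra N => yp'; apply/hasP; exists y.
  have D' y : y \in p -> y \notin p' by apply: contraL => /D.
  case: (ltngtP i' i) => lt; last by rewrite lt eqxx in ii'.
    have l1 : i < j' by lia.
    have l2 : j' < j by lia.
    have [|] := crossing_bound simple_e cumm_c lt l1 l2 jc E' E D sp' sp; lia.
  have l1 : i' < j by lia.
  have l2 : j < j' by lia.
  have [|] := crossing_bound simple_e cumm_c lt l1 l2 jc' E E' D' sp sp'; lia.
have [/andP [uc wc] uw _ _ _] := E.
have := short_ears_even ge cU uc wc uw; rewrite c8 oT => /(_ nT).
suff H z : z \notin c -> exists2 p, ear e (mem c) (nth x0 c i) p (nth x0 c j) & z \in p /\ size p <= 2.
  by move/(_ H).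
move=> zc; have [i' [j' [p' [ij' jc' E' zp]]]] := ear_through_index simple_e tc cumm_c x0 zc.
have sp' : 0 < size p' by case: (p') zp.
have [ei' p2'] := bnd _ _ _ ij' jc' E' sp'.
have ii := same _ _ _ ij' jc' E' sp'.
by exists p' => //; move: E'; rewrite ei' ii -ei.
Qed.

End Bounds.

(** Ensures that a cycle through a vertex with only two neighbours uses both of them. *)
Lemma next_neq_prev (T : eqType) (c : seq T) x : uniq c -> 3 <= size c -> x \in c ->
  next c x != prev c x.
Proof.
move=> U s3 xc; have [n q E] := rot_to xc.
rewrite -(next_rot n U) -(prev_rot n U) E.
move: U s3; rewrite -(rot_uniq n) -(size_rot n) E.
case: q {E} => [|y [|z q]] // /and3P [xyz yzq _] _.
rewrite next_nth prev_nth mem_head /= eqxx /=.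
move: xyz yzq; rewrite !inE !negb_or => /and3P [xy xz xq] yzq.
rewrite [y == x]eq_sym (negPf xy) [z == x]eq_sym (negPf xz) memNindex //=.
rewrite -[nth _ _ _]/(nth x (z :: q) (size (z :: q)).-1) nth_last.
by apply: contraTneq (mem_last z q) => /= <-; rewrite inE negb_or.
Qed.

(** * Theta graphs and their cycles *)

Section Theta.
Variables (I : finType) (s : I -> nat).

Definition theta := (bool + {i : I & 'I_(s i)})%type.

(* [inl false] and [inl true] are the two branch vertices; the inner vertices of
   path [i] are numbered from [inl false] to [inl true]. *)
Definition adj (x y : theta) : bool :=
  match x, y with
  | inr u, inr v => (tag u == tag v) &&
      (((tagged u).+1 == tagged v :> nat) || ((tagged v).+1 == tagged u :> nat))
  | inl b, inr v | inr v, inl b =>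
      if b then (tagged v).+1 == s (tag v) else tagged v == 0 :> nat
  | inl _, inl _ => false
  end.

(** Positions along path [i] with the branch vertices included, at 0 and [(s i).+1], so that
    inductions along a path treat ends and inner vertices alike. Larger positions also give
    [inl true]. *)
Definition at_ i n : theta :=
  if n is m.+1 then
    if insub m is Some j then inr (Tagged (fun i => 'I_(s i)) (j : 'I_(s i))) else inl true
  else inl false.
Arguments at_ : simpl never.

Lemma simple_adj : simple_graph adj.
Proof.
split=> [[a|[i j]] [b|[k l]]|[a|[i j]]] //=; last by rewrite eqxx /= orbb; lia.
by rewrite eq_sym orbC.
Qed.

Lemma at_ord i (j : 'I_(s i)) : at_ i j.+1 = inr (Tagged (fun i => 'I_(s i)) j).
Proof. by rewrite /at_ valK. Qed.

Lemma at_last i : at_ i (s i).+1 = inl true.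
Proof. by rewrite /at_ insubF // ltnn. Qed.

Lemma thetaP x : (exists b, x = inl b) \/ exists i n, n < s i /\ x = at_ i n.+1.
Proof.
case: x => [b|[i j]]; [by left; exists b | right].
by exists i, j; rewrite at_ord ltn_ord.
Qed.

(** For [A] a pair of paths this is the vertex set of the cycle that they form. *)
Definition in_branches (A : pred I) (x : theta) : bool :=
  if x is inr u then A (tag u) else true.

Lemma in_branches_at A i n : n < s i -> in_branches A (at_ i n.+1) = A i.
Proof. by move=> lt; rewrite (at_ord (Ordinal lt)). Qed.

Lemma at_neq i n k m : n < s i -> m < s k -> i != k -> at_ i n.+1 != at_ k m.+1.
Proof.
move=> ni mk; apply: contraNneq => E.
by rewrite -[_ == _]/(pred1 k i) -(in_branches_at (pred1 k) ni) E in_branches_at /=.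
Qed.

Lemma at_inj i n m : n <= (s i).+1 -> m <= (s i).+1 -> at_ i n = at_ i m -> n = m.
Proof.
have val_at k : k <= (s i).+1 -> (if at_ i k is inr u then (tagged u).+1 else
    if at_ i k == inl true then (s i).+1 else 0) = k.
  case: k => [|k] //; rewrite ltnS /at_ => ki; case: insubP => [j _ <- //|] /=.
  by rewrite -leqNgt => ik; congr _.+1; apply/eqP; rewrite eqn_leq ik.
by move=> ni mi E; rewrite -(val_at n) // -(val_at m) // E.
Qed.

Lemma adj_at i n : n <= s i -> 0 < s i -> adj (at_ i n) (at_ i n.+1).
Proof.
move=> ni si; case: n ni => [_|n ni]; first by rewrite (at_ord (Ordinal si)).
rewrite (at_ord (Ordinal ni)).
have /predU1P [h|h] : (n.+1 == s i) || (n.+1 < s i) by rewrite -leq_eqVlt.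
  by rewrite h at_last /= h.
by rewrite (at_ord (Ordinal h)) /= !eqxx.
Qed.

Lemma adj_inner x i n : n < s i -> adj x (at_ i n.+1) -> x = at_ i n \/ x = at_ i n.+2.
Proof.
move=> ni; rewrite (at_ord (Ordinal ni)).
case: x => [[] /= /eqP h|[k j] /= /andP [/eqP ki]].
- by right; rewrite h at_last.
- by left; rewrite h.
- by subst k; case/orP => /eqP h; [left | right]; rewrite -?h ?at_ord // h at_ord.
Qed.

Lemma adj_source x : adj (inl false) x -> exists2 i, 0 < s i & x = at_ i 1.
Proof.
case: x => // -[i j] /= /eqP j0; exists i; first by rewrite -j0.
by rewrite -at_ord /= j0.
Qed.

Hypothesis s_gt0 : forall i, 0 < s i.

Section Connectivity.
Variable v : theta.
Let r := fun a b => [&& adj a b, a != v & b != v].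

Lemma connect_rC : connect_sym r.
Proof. by apply: sym_connect_sym => a b; rewrite /r simple_adj.1 [(a != v) && _]andbC. Qed.

Lemma connect_down i n : n <= (s i).+1 -> (forall m, m <= n -> at_ i m != v) ->
  connect r (at_ i n) (inl false).
Proof.
elim: n => [|n IH] ni h; first exact: connect0.
rewrite connect_rC; apply: connect_trans (connect1 _ : connect r (at_ i n) _).
  by rewrite connect_rC; apply: IH => [|m mn]; [exact: ltnW | apply: h; apply: leqW].
by rewrite /r adj_at // !h.
Qed.

Lemma connect_up i n : n <= (s i).+1 ->
  (forall m, n <= m -> m <= (s i).+1 -> at_ i m != v) -> connect r (at_ i n) (inl true).
Proof.
move=> ni; rewrite -(subKn ni); move: ((s i).+1 - n) => k.
elim: k => [|k IH] h; first by rewrite subn0 at_last connect0.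
case: (leqP (s i).+1 k) => ki.
  have E : (s i).+1 - k.+1 = (s i).+1 - k by lia.
  by rewrite E in h *; apply: IH.
have E : (s i).+1 - k = ((s i).+1 - k.+1).+1 by lia.
apply: connect_trans (IH _); last by move=> m mk mi; apply: h => //; lia.
apply: connect1; rewrite /r E adj_at ?h //; lia.
Qed.

End Connectivity.

(** After deletion of [v] every vertex still reaches one fixed branch vertex: the surviving one if
    [v] is a branch vertex; otherwise one goes along the path away from [v], and a path not
    containing [v] joins the two branch vertices. *)
Lemma theta_two_connected (i0 i1 : I) : i0 != i1 -> two_connected adj.
Proof.
move=> i01.
have del v x y : x != v -> y != v ->
    connect (fun a b => [&& adj a b, a != v & b != v]) x y.
  have C := connect_rC v.
  suff [b hb] : exists b, forall x, x != v ->
      connect (fun a b => [&& adj a b, a != v & b != v]) x (inl b).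
    by move=> xv yv; apply: connect_trans (hb x xv) _; rewrite C; apply: hb.
  case: (thetaP v) => [[b ->]|[i [n [ni ev]]]].
    exists (~~ b) => {}x xb; case: (thetaP x) => [[b' ex]|[i [n [ni ->]]]].
      by rewrite ex in xb *; case: b b' xb {ex C} => [] [].
    have nh m c : m <= s i -> at_ i m.+1 != inl c \/ m = s i /\ c.
      rewrite leq_eqVlt => /orP [/eqP ->|mi]; last by left; rewrite (at_ord (Ordinal mi)).
      by rewrite at_last; case: c; [right | left].
    case: b {xb C} => /=.
      apply: connect_down => [|[|m] mn] //; first by apply: leqW.
      by case: (nh m true) => [||[]] //; lia.
    apply: connect_up => [|[|m] nm mi] //; first by apply: leqW.
    by case: (nh m false) => [||[]] //; lia.
  have nv k m : k != i -> m <= (s k).+1 -> at_ k m != v.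
    move=> ki; case: m => [|m]; first by rewrite ev (at_ord (Ordinal ni)).
    rewrite ltnS leq_eqVlt => /orP [/eqP ->|mk]; first by rewrite at_last ev (at_ord (Ordinal ni)).
    by rewrite ev at_neq.
  have [k ki] : exists k, k != i.
    by case: (eqVneq i i0) => [->|ii0]; [exists i1; rewrite eq_sym | exists i0; rewrite eq_sym].
  have tf : connect (fun a b => [&& adj a b, a != v & b != v]) (inl true) (inl false).
    rewrite -(at_last k); apply: connect_down => // m mk; exact: nv.
  exists false => {}x xv; case: (thetaP x) => [[[] ->]|[j [m [mj ex]]]] //.
  rewrite ex in xv *; case: (eqVneq j i) => [ji|ji]; last first.
    by apply: connect_down => [|p pm]; [apply: leqW | apply: nv => //; lia].
  subst j; case: (ltngtP m n) => mn; last by rewrite mn ev eqxx in xv.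
    apply: connect_down => [|p pm]; first exact: leqW.
    by rewrite ev; apply/eqP => /at_inj; lia.
  apply: connect_trans tf; apply: connect_up => [|p mp pi]; first exact: leqW.
  by rewrite ev; apply/eqP => /at_inj; lia.
split=> // [|x y].
  have U : uniq [:: inl false; inl true; at_ i0 1 : theta].
    by rewrite (at_ord (Ordinal (s_gt0 i0))).
  by rewrite -(card_uniqP U : #|_| = 3) max_card.
have sub v : subrel (connect (fun a b => [&& adj a b, a != v & b != v])) (connect adj).
  by apply: connect_sub => a b /and3P [ab _ _]; apply: connect1.
have U : uniq [:: at_ i0 1; at_ i1 1; inl true : theta].
  rewrite /= !inE !negb_or at_neq //.
  by rewrite (at_ord (Ordinal (s_gt0 i0))) (at_ord (Ordinal (s_gt0 i1))).
(* Connectivity of the whole graph follows by deleting a third vertex. *)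
have [v] : exists v, v \notin [:: x; y].
  by apply: notin_ex; rewrite -(card_uniqP U : #|_| = 3) max_card.
by rewrite !inE negb_or => /andP [vx vy]; apply: (sub v); apply: del; rewrite eq_sym.
Qed.

(** Inner vertices have degree two, so a cycle through one of them contains its whole path. The two
    neighbours of [inl false] on the cycle tell which two paths occur. *)
Lemma theta_cycle c : is_cycle adj c -> exists i j : I, i != j /\
  forall x, (x \in c) = in_branches (pred2 i j) x.
Proof.
case=> U s3 cP.
have np x : x \in c -> next c x != prev c x by apply: next_neq_prev.
have nb i n : n < s i -> at_ i n.+1 \in c ->
    [/\ at_ i n \in c, at_ i n.+2 \in c &
        at_ i n = next c (at_ i n.+1) \/ at_ i n = prev c (at_ i n.+1)].
  move=> ni xc; have := np _ xc.
  have n1 := next_cycle cP xc; rewrite simple_adj.1 in n1.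
  have := prev_cycle cP xc; move: n1.
  have : next c (at_ i n.+1) \in c by rewrite mem_next.
  have : prev c (at_ i n.+1) \in c by rewrite mem_prev.
  move: (next _ _) (prev _ _) => a b bc ac /(adj_inner ni) ha /(adj_inner ni) hb ab.
  by case: ha hb ab => [ea|ea] [eb|eb]; subst a b; rewrite ?eqxx // => _; split; auto.
have down i n : n < s i -> at_ i n.+1 \in c -> at_ i 1 \in c /\ inl false \in c.
  elim: n => [|n IH] ni xc; first by have [h _ _] := nb _ _ ni xc.
  by apply: IH; [exact: ltnW | have [h _ _] := nb _ _ ni xc].
have up i n : n <= s i -> at_ i 1 \in c -> at_ i n.+1 \in c.
  elim: n => [|n IH] ni // xc.
  by have [_ h _] := nb _ _ ni (IH (ltnW ni) xc).
have fc : inl false \in c.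
  suff [i [n [ni xc]]] : exists i n, n < s i /\ at_ i n.+1 \in c by case: (down i n).
  (* The two branch vertices alone are too few for a cycle. *)
  have [x xc xh] : exists2 x, x \in c & x \notin [:: inl false; inl true : theta].
    apply/hasP; rewrite has_predC; apply: contraL s3 => /allP sub.
    by rewrite -leqNgt; apply: (uniq_leq_size (s2 := [:: inl false; inl true : theta])).
  by case: (thetaP x) xh xc => [[[] ->]|[i [n [ni ->]]]] // _ xc; exists i, n.
have [i _ ei] := adj_source (next_cycle cP fc).
have [j _ ej] : exists2 j, 0 < s j & prev c (inl false) = at_ j 1.
  by apply: adj_source; rewrite simple_adj.1; apply: prev_cycle.
have ic : at_ i 1 \in c by rewrite -ei mem_next.
have jc : at_ j 1 \in c by rewrite -ej mem_prev.
exists i, j; split.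
  by apply: contraTneq (np _ fc) => ij; rewrite ei ej ij eqxx.
(* By [nb], [inl false] is the successor or predecessor of [x] on the cycle, so [x] is one of its
   two neighbours there. *)
have hub x : adj (inl false) x -> x \in c -> x = at_ i 1 \/ x = at_ j 1.
  move=> /adj_source [k k0 ->] xc; have [_ _ /= [h|h]] := nb _ _ k0 xc.
    by right; rewrite -ej -[inl false]/(at_ k 0) h prev_next.
  by left; rewrite -ei -[inl false]/(at_ k 0) h next_prev.
move=> x; case: (thetaP x) => [[b ->]|[k [n [nk ->]]]].
  by case: b => //; rewrite /= -(at_last i) up.
rewrite in_branches_at //=; apply/idP/orP => [xc|].
  have [kc _] := down _ _ nk xc.
  have k1 : adj (inl false) (at_ k 1) by apply: (@adj_at k 0).
  case: (hub _ k1 kc) => E; [left | right]; apply: contraT => ne.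
    by have := at_neq (s_gt0 k) (s_gt0 i) ne; rewrite E eqxx.
  by have := at_neq (s_gt0 k) (s_gt0 j) ne; rewrite E eqxx.
by case=> /eqP E; subst k; apply: up => //; apply: ltnW.
Qed.

Lemma card_in_branches (A : pred I) : #|[pred x | in_branches A x]| = 2 + \sum_(i | A i) s i.
Proof.
rewrite -sum1_card big_sumType /=; congr (_ + _).
  by rewrite sum1_card card_bool.
rewrite (eq_bigr (fun i => \sum_(j < s i | true) 1)); last first.
  by move=> i _; rewrite sum1_card card_ord.
by rewrite sig_big_dep /=; apply: eq_bigl => u; rewrite andbT.
Qed.

Lemma card_theta : #|{: theta}| = 2 + \sum_i s i.
Proof. by rewrite -(card_in_branches predT); apply: eq_card => -[]. Qed.

Lemma sum_pred2 (i j : I) : i != j -> \sum_(k | pred2 i j k) s k = s i + s j.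
Proof.
move=> ij; rewrite (bigD1 i) /= ?eqxx // (bigD1 j) /= ?eqxx ?orbT ?(eq_sym j) //.
by rewrite big_pred0 ?addn0 // => k; case: (k == i); case: (k == j).
Qed.

Lemma theta_cycle_size c (i j : I) : is_cycle adj c -> i != j ->
  (forall x, (x \in c) = in_branches (pred2 i j) x) -> size c = 2 + s i + s j.
Proof.
case=> U _ _ ij h; rewrite -(card_uniqP U) -addnA -sum_pred2 // -card_in_branches.
exact: eq_card.
Qed.

Lemma theta_cycle_exists (i j : I) : i != j -> exists2 c, is_cycle adj c & size c = 2 + s i + s j.
Proof.
move=> ij; pose p k := [seq at_ k n | n <- iota 1 (s k)].
have pP k : path adj (inl false) (rcons (p k) (inl true)).
  rewrite -(at_last k) -map_rcons -[inl false]/(at_ k 0) path_map.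
  have -> : rcons (iota 1 (s k)) (s k).+1 = iota 1 (s k).+1.
    by rewrite -[(s k).+1 in RHS]addn1 iotaD cats1 add1n.
  have: forall m n, m + n <= (s k).+1 -> path (relpre (at_ k) adj) m (iota m.+1 n).
    by move=> m n; elim: n m => //= n IH m mn; rewrite adj_at ?IH //; lia.
  by apply.
have sp k : size (p k) = s k by rewrite size_map size_iota.
have pE k x : x \in p k -> exists n, n < s k /\ x = at_ k n.+1.
  by case/mapP => -[|n]; rewrite mem_iota //= => nk ->; exists n; split=> //; lia.
have np k b : inl b \notin p k by apply/negP => /pE [n [nk]]; rewrite (at_ord (Ordinal nk)).
have Up k : uniq (p k).
  rewrite map_inj_in_uniq ?iota_uniq // => m n; rewrite !mem_iota => hm hn; apply: at_inj; lia.
exists (inl false :: p i ++ inl true :: rev (p j)).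
  apply: two_paths_cycle => //; first by apply: path_flip (pP j); apply: simple_adj.1.
    rewrite cons_uniq mem_cat inE mem_rev !negb_or !np /= cat_uniq cons_uniq Up rev_uniq Up.
    rewrite mem_rev np /= andbT negb_or np /=; apply/hasPn => x; rewrite mem_rev => /pE [n [nj ->]].
    by apply/negP => /= /pE [m [mi]]; apply/eqP; apply: at_neq => //; rewrite eq_sym.
  by rewrite size_rev !sp addn_gt0 s_gt0.
by rewrite /= size_cat /= size_rev !sp; lia.
Qed.

Lemma theta_girth g : (forall i j : I, i != j -> g <= 2 + s i + s j) -> girth_at_least adj g.
Proof.
move=> h c cC; have [i [j [ij m]]] := theta_cycle cC.
by rewrite (theta_cycle_size cC ij m); apply: h.
Qed.

(** The hypothesis makes the unordered pair of [i0] and [i1] the only one of maximal total length,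
    so all longest cycles have the same vertex set. *)
Lemma theta_cc (i0 i1 : I) : i0 != i1 ->
  (forall i j : I, i != j -> s i0 + s i1 <= s i + s j -> pred2 i j =1 pred2 i0 i1) ->
  cc adj = 2 + s i0 + s i1.
Proof.
move=> i01 top; have [c0 c0C c0s] := theta_cycle_exists i01.
have mem_top c : is_cycle adj c -> 2 + s i0 + s i1 <= size c ->
    forall x, (x \in c) = in_branches (pred2 i0 i1) x.
  move=> cC; have [i [j [ij m]]] := theta_cycle cC.
  rewrite (theta_cycle_size cC ij m) -!addnA leq_add2l => le x.
  rewrite m; case: x {m} => //= u; exact: top.
have max c : is_cycle adj c -> size c <= size c0.
  move=> cC; rewrite leqNgt; apply/negP => lt.
  have le : 2 + s i0 + s i1 <= size c by rewrite -c0s ltnW.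
  by move: lt; rewrite (theta_cycle_size cC i01 (mem_top c cC le)) c0s ltnn.
have [U _ _] := c0C; rewrite -c0s -(card_uniqP U); apply: eq_card => v.
rewrite inE; apply/in_cummerbundP/idP => [[c [[cC cmax] vc]]|v0]; last by exists c0.
have le : 2 + s i0 + s i1 <= size c by rewrite -c0s; apply: cmax.
by rewrite mem_top ?c0s // -(mem_top c).
Qed.

End Theta.

(** * Relabelling on ['I_n] and the extremal examples *)

Lemma transfer (T : finType) (e : rel T) n g : #|T| = n ->
  simple_graph e -> two_connected e -> girth_at_least e g ->
  exists e' : rel 'I_n, [/\ simple_graph e', two_connected e',
    girth_at_least e' g & cc e' = cc e].
Proof.
move=> <- [se ie] [cT con con'] ge; pose f : 'I_#|T| -> T := enum_val.
have fK : cancel enum_rank f := @enum_rankK T.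
have fI : injective f := @enum_val_inj T _.
have conn (r : rel T) (r' : rel 'I_#|T|) x y : (forall a b, r a b -> r' (enum_rank a) (enum_rank b)) ->
    connect r (f x) (f y) -> connect r' x y.
  move=> rr' /connectP [p P E]; apply/connectP; exists (map enum_rank p).
    by rewrite -(enum_valK x); apply: homo_path P.
  by rewrite -{1}(enum_valK x) last_map -[enum_val x]/(f x) -E enum_valK.
exists (relpre f e).
have cyc c : is_cycle (relpre f e) c <-> is_cycle e (map f c).
  by rewrite /is_cycle map_inj_uniq // size_map cycle_map.
have cum c : cummerbund (relpre f e) c <-> cummerbund e (map f c).
  split=> -[/cyc C M]; split=> // c'.
    by rewrite -(mapK fK c') => /cyc /M; rewrite !size_map.
  by move/cyc/M; rewrite !size_map.
split.
- by split=> [x y|x] /=; [apply: se | apply: ie].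
- split=> [|x y|v x y xv yv]; first by rewrite card_ord.
    by apply: conn (con (f x) (f y)) => a b; rewrite /= !fK.
  apply: conn (con' (f v) (f x) (f y) _ _); rewrite ?(inj_eq fI) //.
  by move=> a b /=; rewrite !fK -!(inj_eq fI) !fK.
- by move=> c /cyc /ge; rewrite size_map.
- rewrite /cc -(card_imset _ fI); apply: eq_card => x.
  rewrite -(fK x) mem_imset // !inE.
  apply/in_cummerbundP/in_cummerbundP => -[c [cC xc]].
    by exists (map f c); split; [apply/cum | apply: map_f].
  exists (map enum_rank c); split; last by rewrite -(mem_map fI) mapK.
  by apply/cum; rewrite mapK.
Qed.

(* The first two paths, of [s0] and [s1] inner vertices, form the only longest cycle. *)
Lemma theta_family n s0 s1 k (t : 'I_k -> nat) g :
  n = 2 + (s0 + s1 + \sum_i t i) ->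
  (forall i, [/\ 0 < t i, t i < s0, t i < s1, g <= 2 + s0 + t i & g <= 2 + s1 + t i]) ->
  (forall i j, i != j -> g <= 2 + t i + t j) ->
  0 < s0 -> 0 < s1 -> g <= 2 + s0 + s1 ->
  exists e : rel 'I_n, [/\ simple_graph e, two_connected e,
    girth_at_least e g & cc e = 2 + s0 + s1].
Proof.
move=> En ht htt h0 h1 g01.
pose s (i : (bool + 'I_k)%type) := match i with inl b => if b then s1 else s0 | inr i => t i end.
have s_gt0 i : 0 < s i by case: i => [[]|i] //=; case: (ht i).
have ne : inl false != inl true :> (bool + 'I_k)%type by [].
have C : #|{: theta s}| = n by rewrite card_theta En big_sumType /= big_bool /= [s1 + s0]addnC.
have [|e [se tc ge ce]] := transfer (g := g) C (simple_adj s) (theta_two_connected s_gt0 ne).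
  apply: theta_girth => // -[b|i] [b'|j] ij.
  - by case: b b' ij => [] [] //= _; rewrite addnAC.
  - by case: (ht j) => *; case: b ij.
  - by case: (ht i) => *; case: b' ij => /= _; rewrite addnAC.
  - exact: htt.
exists e; split=> //; rewrite ce (theta_cc s_gt0 ne) // => -[b|i] [b'|j] ij /=.
- by case: b b' ij => [] [] // _ _ x; rewrite /= orbC.
- by case: b ij; case: (ht j) => /= *; exfalso; lia.
- by case: b' ij; case: (ht i) => /= *; exfalso; lia.
- by case: (ht i); case: (ht j) => *; exfalso; lia.
Qed.

Lemma example_girth4 n : 8 <= n -> exists e : rel 'I_n,
  [/\ simple_graph e, two_connected e, girth_at_least e 4 & cc e = 6].
Proof.
(* The branch vertices and the two long paths use 6 vertices; each remaining vertex is a path of its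
   own. *)
move=> n8; apply: (@theta_family n 2 2 (n - 6) (fun=> 1)) => //.
by rewrite sum_nat_const card_ord; lia.
Qed.

(* The path with a single inner vertex is there to correct the parity. *)
Lemma example_girth5 n : 10 <= n -> exists e : rel 'I_n,
  [/\ simple_graph e, two_connected e, girth_at_least e (6 - odd n) & cc e = 8].
Proof.
move=> n10; pose t i := if odd n && (i == 0) then 1 else 2.
(* Beyond the 8 vertices of the longest cycle, [n - 8] remain: all in pairs for even [n], one single
   vertex and pairs for odd [n]. *)
apply: (@theta_family n 3 3 ((n - 7)./2) (fun i => t i)) => // [||i j ij|].
- have -> : (n - 7)./2 = ((n - 9)./2).+1 by lia.
  rewrite big_ord_recl (eq_bigr (fun=> 2)) /t => [|i _]; last by rewrite andbF.
  by rewrite sum_nat_const card_ord; case: (boolP (odd n)) => /= on; lia.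
- by move=> i; rewrite /t; case: (odd n); case: (_ == 0).
- rewrite /t; case: (odd n) => //=.
  by case: eqP; case: eqP => // j0 i0; case/eqP: ij; apply: val_inj; rewrite /= i0 j0.
- by case: (odd n).
Qed.

(** The longest cycle, of length 9, absorbs the odd parity, so the remaining vertices form paths
    with two inner vertices each. *)
Lemma example_girth6_odd n : 13 <= n -> odd n -> exists e : rel 'I_n,
  [/\ simple_graph e, two_connected e, girth_at_least e 6 & cc e = 9].
Proof.
move=> n13 on; apply: (@theta_family n 3 4 ((n - 9)./2) (fun=> 2)) => //.
by rewrite sum_nat_const card_ord; lia.
Qed.

Theorem theorem16 :
  [/\ (forall n : nat, 8 <= n -> min_cc_eq n 4 6),
      (forall n : nat, 10 <= n -> min_cc_eq n 5 8),
      (forall n : nat, 12 <= n -> ~~ odd n -> min_cc_eq n 6 8) &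
      (forall n : nat, 13 <= n -> odd n -> min_cc_eq n 6 9)].
Proof.
split=> n hn.
- split; last exact: example_girth4.
  by move=> e se tc ge; apply: cc_girth4; rewrite ?card_ord //; apply: leq_trans hn.
- split; first by move=> e se tc ge; apply: cc_girth5; rewrite ?card_ord.
  (* The girth bound [6 - odd n] is at least 5 for either parity. *)
  have [e [se tc ge ce]] := example_girth5 hn; exists e; split=> // c cC.
  by apply: leq_trans (ge c cC); case: (odd n).
- move=> en; split.
    by move=> e se tc ge; apply: cc_girth6; rewrite ?card_ord //; apply: leq_trans hn.
  (* For even [n] the girth bound of the same example is 6. *)
  have [|e] := @example_girth5 n; first by apply: leq_trans hn.
  by rewrite (negPf en); exists e.
- move=> on; split; last exact: example_girth6_odd.
  move=> e se tc ge; apply: cc_girth6_odd; rewrite ?card_ord //; exact: leq_trans hn.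
Qed.
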